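(* Let $m,d,r$ be integers with $1\le r\le m<d$, and let $P^{\star}\in\mathbb{R}^{m\times d}$ be nonzero. Let $U\sim\mathrm{Unif}(\mathrm{St}(m,r))$ be a Haar-uniform random $m\times r$ matrix with orthonormal columns, and let $Q\in\mathbb{R}^{r\times d}$ be a random matrix with $Q^{\top}\sim\mathrm{Unif}(\mathrm{St}(d,r))$ (so $Q$ has orthonormal rows). Then $$\mathbb{E}_{U}\Big[\min_{A\in\mathbb{R}^{r\times d}}\lVert P^{\star}-UA\rVert_F^2\Big]=\Big(1-\frac{r}{m}\Big)\lVert P^{\star}\rVert_F^2,$$ $$\mathbb{E}_{Q}\Big[\min_{B\in\mathbb{R}^{m\times r}}\lVert P^{\star}-BQ\rVert_F^2\Big]=\Big(1-\frac{r}{d}\Big)\lVert P^{\star}\rVert_F^2.$$ Consequently, $$\mathbb{E}_{U}\Big[\min_{A\in\mathbb{R}^{r\times d}}\lVert P^{\star}-UA\rVert_F^2\Big]<\mathbb{E}_{Q}\Big[\min_{B\in\mathbb{R}^{m\times r}}\lVert P^{\star}-BQ\rVert_F^2\Big].$$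
   Context: $\lVert\cdot\rVert_F$ is the Frobenius norm. For $1\le r\le n$, $\mathrm{St}(n,r)=\{V\in\mathbb{R}^{n\times r}: V^{\top}V=I_r\}$ is the Stiefel manifold, and $\mathrm{Unif}(\mathrm{St}(n,r))$ is the Haar-uniform distribution on it, i.e. the unique Borel probability measure on $\mathrm{St}(n,r)$ invariant under $V\mapsto OV$ for every orthogonal matrix $O\in\mathbb{R}^{n\times n}$. *)

(* Defs.v *)
From HB Require Import structures.
From mathcomp Require Import all_boot all_order all_algebra.
From mathcomp Require Import all_classical all_reals all_analysis.

Set Implicit Arguments.
Unset Strict Implicit.
Unset Printing Implicit Defensive.

Import Order.TTheory GRing.Theory Num.Theory.
Import numFieldNormedType.Exports.

Local Open Scope classical_set_scope.
Local Open Scope ring_scope.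

(* The library puts no sigma-algebra on matrices: this alias carries the Borel
   one, generated by the open sets of the entrywise topology. *)
Definition mxborel (R : realType) (m n : nat) : Type :=
  g_sigma_algebraType (@open 'M[R]_(m, n)).

HB.instance Definition _ (R : realType) (m n : nat) :=
  Measurable.copy (mxborel R m n) (g_sigma_algebraType (@open 'M[R]_(m, n))).

Definition frobenius_norm (R : realType) (m n : nat) (A : 'M[R]_(m, n)) : R :=
  Num.sqrt (\sum_(i < m) \sum_(j < n) A i j ^+ 2).

Definition stiefel (R : realType) (n r : nat) : set 'M[R]_(n, r) :=
  [set V | V^T *m V = 1%:M].

(* [mu] is the law Unif(St(n, r)), described by the properties that
   characterize it uniquely; a Borel probability measure on the closed set
   St(n, r) is encoded as one on all n x r matrices giving St(n, r) mass 1. *)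
Definition is_unif_stiefel (R : realType) (n r : nat)
    (mu : probability (mxborel R n r) R) : Prop :=
  mu (@stiefel R n r) = 1%E /\
  forall O : 'M[R]_n, O^T *m O = 1%:M ->
    forall A : set (mxborel R n r), measurable A ->
      mu [set V | A (O *m V)] = mu A.

(* This is the minimum of [f] as soon as [f] has a minimizer, which has to be
   asserted separately, with [has_argmin]. *)
Definition inf_val (R : realType) (T : Type) (f : T -> R) : R := inf (range f).

Definition has_argmin (R : realType) (T : Type) (f : T -> R) : Prop :=
  exists x0, forall x, f x0 <= f x.

Lemma continuous_trmx (R : realType) (m n : nat) :
  continuous (trmx : 'M[R]_(m, n) -> 'M[R]_(n, m)).
Proof.
move=> A B [P HP sPB].
exists (fun i j => P j i) => [i j|M HM].
  by have := HP j i; rewrite mxE.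
by apply: sPB => i j; rewrite mxE; exact: HM.
Qed.

Definition mxborel_trmx (R : realType) (m n : nat) (A : mxborel R m n) :
  mxborel R n m := (A : 'M[R]_(m, n))^T.

Lemma measurable_trmx (R : realType) (m n : nat) :
  measurable_fun [set: mxborel R m n] (@mxborel_trmx R m n).
Proof.
apply: (@measurability _ _ _ (mxborel R n m) _ _ (@open 'M[R]_(n, m))) => //.
move=> _ [B oB <-]; rewrite setTI; apply: sub_sigma_algebra.
by apply: open_comp => // A _; exact: continuous_trmx.
Qed.

HB.instance Definition _ (R : realType) (m n : nat) :=
  isMeasurableFun.Build _ _ (mxborel R m n) (mxborel R n m)
    (@mxborel_trmx R m n) (@measurable_trmx R m n).

(* Main.v *)
(* For V with orthonormal columns, ||P - V A||^2 is minimal at A = V^T P, with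
   value ||P||^2 - tr(P P^T (V V^T)). Left invariance of the law of V under sign
   changes and transpositions of coordinates makes E[V V^T] a scalar matrix, and
   tr(V V^T) = r forces E[V V^T] = (r/n) I, whence the expected minimum
   (1 - r/n) ||P||^2. The loss for Q is the loss for Q^T and P^T. *)
Require Import Defs.
From HB Require Import structures.
From mathcomp Require Import all_boot all_order all_algebra.
From mathcomp Require Import all_classical all_reals all_analysis.
From mathcomp Require Import measurable_realfun ring.
Import Order.TTheory GRing.Theory Num.Theory.
Import numFieldNormedType.Exports.
Local Open Scope classical_set_scope.
Local Open Scope ring_scope.

Set Implicit Arguments.
Unset Strict Implicit.
Unset Printing Implicit Defensive.

(** * Continuity of matrix operations *)

Lemma continuous_mx (R : realType) (T : topologicalType) (m n : nat)
    (f : T -> 'M[R]_(m, n)) :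
  (forall i j, continuous (fun t => f t i j)) -> continuous f.
Proof.
move=> cf t A [P Pf sPA].
(* There are finitely many entries, so the entrywise conditions hold simultaneously near [t]. *)
have H : \forall s \near t, forall ij : 'I_m * 'I_n, P ij.1 ij.2 (f s ij.1 ij.2).
  apply: filter_forall => -[i j]; exact: cf (Pf i j).
apply: filterS H => s H; apply: sPA => i j; exact: (H (i, j)).
Qed.

Lemma continuous_sum (R : realType) (T : topologicalType) (n : nat)
    (f : 'I_n -> T -> R) :
  (forall i, continuous (f i)) -> continuous (fun t => \sum_i f i t).
Proof.
move=> cf; apply: continuous_big => //; exact: add_continuous.
Qed.

Lemma continuous_mulmx (R : realType) (T : topologicalType) (m n p : nat)
    (f : T -> 'M[R]_(m, n)) (g : T -> 'M[R]_(n, p)) :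
  continuous f -> continuous g -> continuous (fun t => f t *m g t).
Proof.
move=> cf cg; apply: continuous_mx => i j.
under eq_fun do rewrite mxE.
apply: continuous_sum => k t.
apply: continuousM.
  exact: (continuous_comp (cf t) (@coord_continuous _ _ _ i k _)).
exact: (continuous_comp (cg t) (@coord_continuous _ _ _ k j _)).
Qed.

Lemma continuous_mulmxl (R : realType) (m n p : nat) (O : 'M[R]_(m, n)) :
  continuous (mulmx O : 'M[R]_(n, p) -> 'M[R]_(m, p)).
Proof.
apply: (@continuous_mulmx _ _ _ _ _ (cst O) id); first exact: cst_continuous.
by move=> V; exact: cvg_id.
Qed.

Lemma continuous_mxtrace (R : realType) (n : nat) :
  continuous (@mxtrace R n).
Proof.
by apply: continuous_sum => i; exact: coord_continuous.
Qed.

(** * Frobenius norm and the least-squares identity *)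

Lemma frobenius_normE (R : realType) (m n : nat) (A : 'M[R]_(m, n)) :
  frobenius_norm A ^+ 2 = \tr (A^T *m A).
Proof.
rewrite sqr_sqrtr; last by do 2 (apply: sumr_ge0 => ? _); exact: sqr_ge0.
rewrite exchange_big; apply: eq_bigr => j _.
by rewrite mxE; apply: eq_bigr => i _; rewrite mxE.
Qed.

Lemma frobenius_norm_trmx (R : realType) (m n : nat) (A : 'M[R]_(m, n)) :
  frobenius_norm A^T = frobenius_norm A.
Proof.
rewrite /frobenius_norm exchange_big; congr (Num.sqrt _).
by apply: eq_bigr => i _; apply: eq_bigr => j _; rewrite mxE.
Qed.

(** Pythagoras: [P - V A] splits into [P - V V^T P], orthogonal to the columns of [V], and
    [V (V^T P - A)], whose norm is that of [V^T P - A] because [V] is an isometry. Only the last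
    term depends on [A]. *)
Lemma loss_decomp (R : realType) (n k r : nat) (P : 'M[R]_(n, k))
    (V : 'M[R]_(n, r)) (A : 'M[R]_(r, k)) : stiefel V ->
  frobenius_norm (P - V *m A) ^+ 2 =
  frobenius_norm P ^+ 2 - \tr (P *m P^T *m (V *m V^T))
    + frobenius_norm (V^T *m P - A) ^+ 2.
Proof.
move=> VV.
(* By cyclicity of the trace, the subtracted term is the squared norm of [V^T P]. *)
have -> : \tr (P *m P^T *m (V *m V^T)) = \tr ((V^T *m P)^T *m (V^T *m P)).
  by rewrite trmx_mul trmxK -mulmxA mxtrace_mulC !mulmxA.
have trB (p q : nat) (X Y : 'M[R]_(p, q)) : (X - Y)^T = X^T - Y^T.
  by rewrite linearB.
have trXB (p : nat) (X Y : 'M[R]_p) : \tr (X - Y) = \tr X - \tr Y.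
  by rewrite linearB.
rewrite !frobenius_normE !trB !mulmxBl !mulmxBr !trXB !trmx_mul trmxK.
rewrite !mulmxA -(mulmxA _ V^T V) VV mulmx1.
ring.
Qed.

Lemma inf_val_min (R : realType) (T : Type) (f : T -> R) (x0 : T) :
  (forall x, f x0 <= f x) -> inf_val f = f x0.
Proof.
move=> fx0.
have lb : lbound (range f) (f x0) by move=> _ [x _ <-].
apply/eqP; rewrite eq_le; apply/andP; split.
  by apply: ge_inf; [exists (f x0) | exists x0].
by apply: lb_le_inf => //; exists (f x0), x0.
Qed.

(** * Borel measurability on matrix spaces *)

Section BorelMatrix.
Variables (R : realType) (n r : nat).
Local Notation T := (mxborel R n r).

Lemma open_mxborel_measurable (A : set 'M[R]_(n, r)) :
  open A -> measurable (A : set T).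
Proof. exact: sub_sigma_algebra. Qed.

(** The open left rays generate the Borel sets of the line. Upper semicontinuity is the form in
    which the minimal loss is later shown to be measurable. *)
Lemma usc_mxborel_measurable (f : 'M[R]_(n, r) -> R) :
  (forall a, open [set V | f V < a]) -> measurable_fun [set: T] (f : T -> R).
Proof.
move=> fo.
apply: (measurability _ (RGenInftyO.measurableE R)).
move=> _ [_ [a ->] <-]; rewrite setTI.
rewrite (_ : _ @^-1` _ = [set V : 'M[R]_(n, r) | f V < a]).
  exact: open_mxborel_measurable.
by apply/seteqP; split => V /=; rewrite in_itv.
Qed.

Lemma continuous_mxborel_measurable (f : 'M[R]_(n, r) -> R) :
  continuous f -> measurable_fun [set: T] (f : T -> R).
Proof.
move=> cf; apply: usc_mxborel_measurable => a.
exact: (open_comp (fun V _ => cf V) (@open_lt _ a)).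
Qed.

(** The Stiefel manifold is closed, as the preimage of a point under the continuous map sending [V]
    to [V^T V]. *)
Lemma measurable_stiefel : measurable (@stiefel R n r : set T).
Proof.
rewrite -(setCK (@stiefel R n r : set T)).
apply: measurableC; apply: open_mxborel_measurable; apply: closed_openC.
apply: (@preimage_closed 'M[R]_(n, r) 'M[R]_r (fun V => V^T *m V) [set 1%:M]).
  move=> V _; move: V; apply: continuous_mulmx; first exact: continuous_trmx.
  by move=> V; exact: cvg_id.
apply: accessible_closed_set1; apply: hausdorff_accessible; exact: norm_hausdorff.
Qed.

Lemma measurable_mulmxl (O : 'M[R]_n) :
  measurable_fun [set: T] (fun V : T => (O *m (V : 'M[R]_(n, r)) : T)).
Proof.
apply: (@measurability _ _ _ T _ _ (@open 'M[R]_(n, r))) => //.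
move=> _ [B oB <-]; rewrite setTI; apply: sub_sigma_algebra.
by apply: open_comp => // V _; exact: continuous_mulmxl.
Qed.

End BorelMatrix.

(** * Invariance and boundedness on the Stiefel manifold *)

Lemma stiefel_mulmxl (R : realType) (n r : nat) (O : 'M[R]_n)
    (V : 'M[R]_(n, r)) :
  O^T *m O = 1%:M -> stiefel (O *m V) = stiefel V.
Proof.
by move=> OO; rewrite /stiefel/= trmx_mul mulmxA -(mulmxA _ O^T) OO mulmx1.
Qed.

(** Column [k] is a unit vector, and [V i k ^+ 2] is one term of its sum of squares. *)
Lemma stiefel_entry_le1 (R : realType) (n r : nat) (V : 'M[R]_(n, r)) i k :
  stiefel V -> `|V i k| <= 1.
Proof.
move=> /(congr1 (fun M : 'M[R]_r => M k k)); rewrite !mxE eqxx mulr1n => H.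
rewrite -sqrtr_sqr -sqrtr1 ler_wsqrtr// -H (bigD1 i)//= mxE lerDl.
by apply: sumr_ge0 => j _; rewrite mxE -expr2 sqr_ge0.
Qed.

(** A crude bound, by [r] products of entries of modulus at most 1; it is enough for
    integrability. *)
Lemma stiefel_gram_le (R : realType) (n r : nat) (V : 'M[R]_(n, r)) i j :
  stiefel V -> `|(V *m V^T) i j| <= r%:R.
Proof.
move=> sV; rewrite mxE (le_trans (ler_norm_sum _ _ _))//.
rewrite -[r in leRHS]card_ord -sumr_const ler_sum// => k _.
by rewrite mxE normrM mulr_ile1// stiefel_entry_le1.
Qed.

(** * Finite sums under the integral *)

Lemma integrable_sumR d (X : measurableType d) (R : realType)
    (mu : {measure set X -> \bar R}) (D : set X) (I : Type) (s : seq I)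
    (F : I -> X -> R) :
  measurable D -> (forall i, mu.-integrable D (EFin \o F i)) ->
  mu.-integrable D (EFin \o (fun x => \sum_(i <- s) F i x)).
Proof.
move=> mD iF.
rewrite (_ : _ \o _ = fun x => (\sum_(i <- s) (F i x)%:E)%E).
  by apply: integrable_sum => // i _; exact: iF.
by apply/funext => x; rewrite /= sumEFin.
Qed.

Lemma Rintegral_sum d (X : measurableType d) (R : realType)
    (mu : {measure set X -> \bar R}) (D : set X) (I : Type) (s : seq I)
    (F : I -> X -> R) :
  measurable D -> (forall i, mu.-integrable D (EFin \o F i)) ->
  \int[mu]_(x in D) (\sum_(i <- s) F i x) =
  \sum_(i <- s) \int[mu]_(x in D) F i x.
Proof.
move=> mD iF; rewrite /Rintegral.
under eq_integral do rewrite -sumEFin.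
rewrite integral_sum// -sum_fine// => i _.
by apply: integrable_fin_num => //; exact: iF.
Qed.

(** * Second moments of the uniform law on the Stiefel manifold *)

Section HaarMoment.
Variables (R : realType) (n r : nat) (mu : probability (mxborel R n r) R).
Hypothesis hmu : is_unif_stiefel mu.
Local Notation S := (@stiefel R n r).
Local Notation T := (mxborel R n r).
Let mS : measurable (S : set T) := @measurable_stiefel R n r.

(** The integrals are taken over [S], of mass 1, because the integrands of interest are bounded
    there but not on all matrices. *)
Lemma integrable_stiefel (h : 'M[R]_(n, r) -> R) (C : R) :
  continuous h -> (forall V, S V -> `|h V| <= C) ->
  mu.-integrable (S : set T) (EFin \o (h : T -> R)).
Proof.
move=> ch hC; apply: measurable_bounded_integrable => //.
- by rewrite [X in (X < _)%E]hmu.1 ltry.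
- by apply: measurable_funTS; exact: (continuous_mxborel_measurable ch).
- exists C; split; first exact: num_real.
  by move=> M CM V SV; exact: le_trans (hC V SV) (ltW CM).
Qed.

(** Change of variables along left multiplication by [O], which preserves both [S] and [mu]. The
    bound [C] provides integrability. *)
Lemma Rintegral_stiefel_mulmxl (h : 'M[R]_(n, r) -> R) (C : R) (O : 'M[R]_n) :
  continuous h -> (forall V, S V -> `|h V| <= C) -> O^T *m O = 1%:M ->
  \int[mu]_(V in (S : set T)) h (O *m V) = \int[mu]_(V in (S : set T)) h V.
Proof.
move=> ch hC OO.
pose phi : T -> T := fun V => O *m (V : 'M[R]_(n, r)).
have mphi : measurable_fun [set: T] phi := @measurable_mulmxl R n r O.
have phiS : phi @^-1` S = S.
  by apply/seteqP; split => V; rewrite /preimage/phi/= stiefel_mulmxl.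
have chO : continuous (fun V : 'M[R]_(n, r) => h (O *m V)).
  by move=> V; exact: (continuous_comp (@continuous_mulmxl _ _ _ _ O V) (ch _)).
have := @integral_pushforward _ _ _ _ R phi mphi mu S (EFin \o (h : T -> R)).
rewrite phiS => /(_ _ _ mS) H.
(* The left side becomes an integral of [h] against the pushforward of [mu], which agrees with [mu]
   on measurable sets. *)
rewrite /Rintegral -[X in fine X]H.
- congr fine; apply: eq_measure_integral => A mA _.
  exact: (hmu.2 _ OO _ mA).
- by apply/measurable_EFinP; exact: continuous_mxborel_measurable.
- apply: (@integrable_stiefel (fun V => h (O *m V)) C) => // V SV.
  by apply: hC; rewrite stiefel_mulmxl.
Qed.

Lemma continuous_gram i j : continuous (fun V : 'M[R]_(n, r) => (V *m V^T) i j).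
Proof.
have cg : continuous (fun V : 'M[R]_(n, r) => V *m V^T).
  apply: continuous_mulmx; last exact: continuous_trmx.
  by move=> V; exact: cvg_id.
by move=> V; exact: (continuous_comp (cg V) (@coord_continuous _ _ _ i j _)).
Qed.

Lemma integrable_gram i j :
  mu.-integrable (S : set T)
    (EFin \o (fun V : T => ((V : 'M[R]_(n, r)) *m (V : 'M[R]_(n, r))^T) i j)).
Proof.
apply: (@integrable_stiefel (fun V => (V *m V^T) i j) r%:R).
  exact: continuous_gram.
by move=> V; exact: stiefel_gram_le.
Qed.

Local Notation gram i j :=
  (\int[mu]_(V in (S : set T)) ((V : 'M[R]_(n, r)) *m (V : 'M[R]_(n, r))^T) i j).

(** Replacing [V] by [O V] conjugates [V V^T] by [O], so the mean of [V V^T] is fixed by orthogonal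
    conjugation. *)
Lemma gram_mulmxl (O : 'M[R]_n) i j : O^T *m O = 1%:M ->
  \int[mu]_(V in (S : set T))
     (O *m ((V : 'M[R]_(n, r)) *m (V : 'M[R]_(n, r))^T) *m O^T) i j = gram i j.
Proof.
move=> OO.
rewrite -(@Rintegral_stiefel_mulmxl (fun V => (V *m V^T) i j) r%:R O) //.
- by apply: eq_Rintegral => V _; rewrite trmx_mul !mulmxA.
- exact: continuous_gram.
- by move=> V; exact: stiefel_gram_le.
Qed.

(* Changing the sign of the i-th row of V changes the sign of the (i, j) entry
   of V V^T. *)
Lemma gram_offdiag i j : i != j -> gram i j = 0.
Proof.
move=> ij; pose D : 'rV[R]_n := \row_k (if k == i then -1 else 1).
have DD : (diag_mx D)^T *m diag_mx D = 1%:M.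
  rewrite tr_diag_mx mulmx_diag -[RHS]diag_const_mx; congr diag_mx.
  by apply/rowP => k; rewrite !mxE; case: eqP; rewrite ?mulrNN mulr1.
have DGD (G : 'M[R]_n) : (diag_mx D *m G *m (diag_mx D)^T) i j = -1 * G i j.
  rewrite tr_diag_mx mul_mx_diag mxE mul_diag_mx /D !mxE eqxx eq_sym.
  by rewrite (negbTE ij) mulr1.
have := gram_mulmxl i j DD.
under eq_Rintegral do rewrite DGD.
rewrite RintegralZl//; last exact: integrable_gram.
(* The entry equals its own opposite, hence vanishes. *)
by rewrite mulN1r => /eqP; rewrite eq_sym -addr_eq0 -mulr2n mulrn_eq0/= => /eqP.
Qed.

(** Conjugation by the transposition of [i] and [j] moves the [i]-th diagonal entry to position
    [j]. *)
Lemma gram_diag_eq i j : gram i i = gram j j.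
Proof.
pose O : 'M[R]_n := tperm_mx i j.
have OO : O^T *m O = 1%:M.
  by rewrite tr_tperm_mx /O /tperm_mx -perm_mxM perm.tperm2 perm_mx1.
have OGO (G : 'M[R]_n) : (O *m G *m O^T) j j = G i i.
  by rewrite tr_tperm_mx -xrowE -xcolE /xcol /xrow !mxE perm.tpermR.
by rewrite -(gram_mulmxl j j OO); apply: eq_Rintegral => V _; rewrite OGO.
Qed.

(** The [n] diagonal entries share one mean, and their sum is [\tr (V^T V)], which is [r] on [S]. *)
Lemma gram_diag i : gram i i = r%:R / n%:R.
Proof.
(* The index [i] witnesses that ['I_n] is inhabited. *)
have n0 : n%:R != 0 :> R by rewrite pnatr_eq0; case: n i => [[]|].
have H : \sum_j gram j j = r%:R.
  rewrite -(Rintegral_sum _ mS); last by move=> j; exact: integrable_gram.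
  rewrite (@eq_Rintegral _ _ _ _ _ (cst r%:R)); last first.
    by move=> V /set_mem SV; rewrite -[LHS]/(\tr _) mxtrace_mulC SV mxtrace1.
  by rewrite Rintegral_cst; [rewrite [X in fine X](hmu.1) mulr1|exact: mS].
rewrite -H (eq_bigr (fun=> gram i i)); last by move=> j _; exact: gram_diag_eq.
by rewrite sumr_const card_ord -[X in _ = X / _]mulr_natr mulfK.
Qed.

Lemma integrable_scale_gram (c : R) i j :
  mu.-integrable (S : set T) (EFin \o (fun V : T =>
    c * ((V : 'M[R]_(n, r)) *m (V : 'M[R]_(n, r))^T) i j)).
Proof. exact: (integrableZl mS c (integrable_gram i j)). Qed.

Lemma integrable_gram_quad (M : 'M[R]_n) :
  mu.-integrable (S : set T) (EFin \o (fun V : T =>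
    \tr (M *m ((V : 'M[R]_(n, r)) *m (V : 'M[R]_(n, r))^T)))).
Proof.
apply: (integrable_sumR _ mS) => i.
under [X in EFin \o X]eq_fun do rewrite mxE.
by apply: (integrable_sumR _ mS) => j; exact: integrable_scale_gram.
Qed.

Lemma gram_quad (M : 'M[R]_n) :
  \int[mu]_(V in (S : set T))
    \tr (M *m ((V : 'M[R]_(n, r)) *m (V : 'M[R]_(n, r))^T)) =
  r%:R / n%:R * \tr M.
Proof.
under eq_Rintegral => V _.
  rewrite /mxtrace.
  under eq_bigr do rewrite mxE.
  over.
rewrite (Rintegral_sum _ mS); last first.
  by move=> i; apply: (integrable_sumR _ mS) => j; exact: integrable_scale_gram.
rewrite /mxtrace mulr_sumr; apply: eq_bigr => i _.
rewrite (Rintegral_sum _ mS); last by move=> j; exact: integrable_scale_gram.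
(* In row [i] of the expanded trace, only the diagonal moment survives. *)
rewrite (bigD1 i)//= big1 ?addr0; last first.
  move=> j ji; rewrite RintegralZl//; last exact: integrable_gram.
  by rewrite gram_offdiag// mulr0.
by rewrite RintegralZl//; [rewrite gram_diag mulrC|exact: integrable_gram].
Qed.

End HaarMoment.

(** * Least-squares loss for a given left factor, and its expected minimum *)

Definition proj_loss (R : realType) (n k r : nat) (P : 'M[R]_(n, k))
    (V : 'M[R]_(n, r)) (A : 'M[R]_(r, k)) : R :=
  frobenius_norm (P - V *m A) ^+ 2.

Section ProjLoss.
Variables (R : realType) (n k r : nat) (P : 'M[R]_(n, k)).
Local Notation S := (@stiefel R n r).
Local Notation T := (mxborel R n r).

Lemma proj_loss_min (V : 'M[R]_(n, r)) : S V ->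
  forall A, proj_loss P V (V^T *m P) <= proj_loss P V A.
Proof.
move=> SV A; rewrite /proj_loss (loss_decomp P A SV).
rewrite (loss_decomp P (V^T *m P) SV) lerD2l subrr.
by rewrite [leLHS]frobenius_normE mulmx0 mxtrace0 sqr_ge0.
Qed.

Lemma inf_proj_loss (V : 'M[R]_(n, r)) : S V ->
  inf_val (proj_loss P V) =
  frobenius_norm P ^+ 2 - \tr (P *m P^T *m (V *m V^T)).
Proof.
move=> SV; rewrite (inf_val_min (proj_loss_min SV)) /proj_loss.
rewrite (loss_decomp P (V^T *m P) SV).
by rewrite subrr [X in _ + X]frobenius_normE mulmx0 mxtrace0 addr0.
Qed.

(** Stated for every [V], on [S] or not, since the expectation is an integral over all matrices. *)
Lemma inf_proj_loss_ge0 (V : 'M[R]_(n, r)) : 0 <= inf_val (proj_loss P V).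
Proof.
apply: lb_le_inf; first by exists (proj_loss P V 0), 0.
by move=> _ [A _ <-]; exact: sqr_ge0.
Qed.

Lemma continuous_proj_loss (A : 'M[R]_(r, k)) :
  continuous (fun V : 'M[R]_(n, r) => proj_loss P V A).
Proof.
have cr : continuous (fun V : 'M[R]_(n, r) => P - V *m A).
  have cVA : continuous (fun V : 'M[R]_(n, r) => V *m A).
    apply: (@continuous_mulmx _ _ _ _ _ id (cst A)); last exact: cst_continuous.
    by move=> V; exact: cvg_id.
  apply: continuous_mx => i j.
  rewrite (_ : (fun _ => _) = fun V : 'M[R]_(n, r) => P i j - (V *m A) i j).
    move=> V; apply: (@continuousB _ R); first exact: cst_continuous.
    exact: (continuous_comp (cVA V) (@coord_continuous _ _ _ i j _)).
  by apply/funext => V; rewrite mxE; congr (_ + _); rewrite mxE.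
rewrite /proj_loss; under eq_fun do rewrite frobenius_normE.
have ct := continuous_mulmx
  (fun V => continuous_comp (cr V) (@continuous_trmx _ _ _ _)) cr.
by move=> V; exact: (continuous_comp (ct V) (@continuous_mxtrace _ _ _)).
Qed.

(* As an infimum of continuous functions of V, the minimum is upper
   semicontinuous. *)
Lemma measurable_inf_proj_loss :
  measurable_fun [set: T] ((fun V => inf_val (proj_loss P V)) : T -> R).
Proof.
apply: (@usc_mxborel_measurable _ _ _ (fun V => inf_val (proj_loss P V))) => a.
rewrite (_ : [set _ | _] =
    \bigcup_A [set V : 'M[R]_(n, r) | proj_loss P V A < a]).
  apply: bigcup_open => A _.
  exact: (open_comp (fun V _ => @continuous_proj_loss A V) (@open_lt _ a)).
apply/seteqP; split => V /=.
  move=> /inf_lt[|_ [A _ <-] Aa]; last by exists A.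
  by exists (proj_loss P V 0), 0.
move=> [A _ /= Aa]; apply: le_lt_trans Aa; apply: ge_inf; last by exists A.
by exists 0 => _ [B _ <-]; exact: sqr_ge0.
Qed.

Lemma expectation_inf_proj_loss (mu : probability T R) :
  is_unif_stiefel mu ->
  (\int[mu]_V (inf_val (proj_loss P (V : 'M[R]_(n, r))))%:E =
   ((1 - r%:R / n%:R) * frobenius_norm P ^+ 2)%:E)%E.
Proof.
move=> hmu.
have mS : measurable (S : set T) := @measurable_stiefel R n r.
(* The complement of [S] is null; discarding it leaves only matrices for which the closed form of
   the minimum holds. *)
rewrite (@ge0_negligible_integral _ _ _ _ setT (~` (S : set T))); first last.
- by have := probability_setC mu mS; rewrite hmu.1 subee.
- by move=> V _; rewrite lee_fin inf_proj_loss_ge0.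
- by apply/measurable_EFinP; exact: measurable_inf_proj_loss.
- exact: measurableT.
- exact: measurableC.
rewrite setTD setCK.
have ig : mu.-integrable (S : set T) (EFin \o (fun V : T =>
    \tr (P *m P^T *m ((V : 'M[R]_(n, r)) *m (V : 'M[R]_(n, r))^T)))).
  exact: integrable_gram_quad.
have ic : mu.-integrable (S : set T) (EFin \o cst (frobenius_norm P ^+ 2)).
  apply: (@integrable_stiefel _ _ _ mu hmu (cst (frobenius_norm P ^+ 2))
    (frobenius_norm P ^+ 2)) => [|V _]; first exact: cst_continuous.
  by rewrite ger0_norm// sqr_ge0.
under eq_integral => V SV.
  rewrite inf_proj_loss; last exact: (set_mem SV).
  over.
(* Integrability makes the extended integral finite, so the computation can continue with real
   integrals. *)
rewrite -[LHS]fineK; last exact: (integrable_fin_num mS (integrableB mS ic ig)).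
congr (_%:E); rewrite -/(Rintegral _ _ _) RintegralB//.
rewrite gram_quad// Rintegral_cst// [X in fine X](hmu.1) mulr1.
by rewrite -frobenius_norm_trmx (frobenius_normE P^T) trmxK mulrBl mul1r.
Qed.

End ProjLoss.

(** * Transfer to the random matrices, and comparison of the two expectations *)

Unset Implicit Arguments.
Set Strict Implicit.
Set Printing Implicit Defensive.

Theorem theorem1 (R : realType) (m d r : nat)
    (hr : (1 <= r)%N) (hrm : (r <= m)%N) (hmd : (m < d)%N)
    (Pstar : 'M[R]_(m, d)) (hP : Pstar != 0)
    (disp1 : measure_display) (Omega1 : measurableType disp1)
    (P1 : probability Omega1 R) (U : {RV P1 >-> mxborel R m r})
    (hU : is_unif_stiefel (distribution P1 U))
    (disp2 : measure_display) (Omega2 : measurableType disp2)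
    (P2 : probability Omega2 R) (Q : {RV P2 >-> mxborel R r d})
    (hQ : is_unif_stiefel (distribution P2 (@mxborel_trmx R r d \o Q))) :
  let lossU (V : 'M[R]_(m, r)) (A : 'M[R]_(r, d)) :=
    frobenius_norm (Pstar - V *m A) ^+ 2 in
  let lossQ (W : 'M[R]_(r, d)) (B : 'M[R]_(m, r)) :=
    frobenius_norm (Pstar - B *m W) ^+ 2 in
  let EU := 'E_P1[fun w => inf_val (lossU (U w))]%E in
  let EQ := 'E_P2[fun w => inf_val (lossQ (Q w))]%E in
  [/\ forall V : 'M[R]_(m, r), stiefel V -> has_argmin (lossU V),
      forall W : 'M[R]_(r, d), stiefel W^T -> has_argmin (lossQ W),
      EU = ((1 - r%:R / m%:R) * frobenius_norm Pstar ^+ 2)%:E,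
      EQ = ((1 - r%:R / d%:R) * frobenius_norm Pstar ^+ 2)%:E
    & (EU < EQ)%E].
Proof.
move=> lossU lossQ EU EQ.
have r0 : (0 < r%:R :> R) by rewrite ltr0n.
have lossQE (W : 'M[R]_(r, d)) B : lossQ W B = proj_loss Pstar^T W^T B^T.
  by rewrite /lossQ /proj_loss -trmx_mul -frobenius_norm_trmx linearB.
(* Transposition is a bijection between the competitors [B] and those of the transposed problem, so
   both losses have the same range. *)
have infQE (W : 'M[R]_(r, d)) :
    inf_val (lossQ W) = inf_val (proj_loss Pstar^T W^T).
  congr inf; apply/seteqP; split => _ [B _ <-].
    by exists B^T => //; rewrite lossQE.
  by exists B^T => //; rewrite lossQE trmxK.
have EUE : EU = ((1 - r%:R / m%:R) * frobenius_norm Pstar ^+ 2)%:E.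
  rewrite -(expectation_inf_proj_loss Pstar hU) ge0_integral_distribution//.
  - by rewrite /EU expectation.unlock.
  - by apply/measurable_EFinP; exact: measurable_inf_proj_loss.
  - by move=> V; rewrite lee_fin inf_proj_loss_ge0.
have EQE : EQ = ((1 - r%:R / d%:R) * frobenius_norm Pstar ^+ 2)%:E.
  rewrite -frobenius_norm_trmx -(expectation_inf_proj_loss Pstar^T hQ).
  rewrite ge0_integral_distribution//.
  - rewrite /EQ expectation.unlock; apply: eq_integral => w _ /=.
    by rewrite infQE.
  - by apply/measurable_EFinP; exact: measurable_inf_proj_loss.
  - by move=> V; rewrite lee_fin inf_proj_loss_ge0.
split=> //.
- by move=> V SV; exists (V^T *m Pstar); exact: proj_loss_min.
(* The witness is the transpose of the minimizer for [Pstar^T] and [W^T]. *)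
- move=> W SW; exists ((W^T)^T *m Pstar^T)^T => B.
  rewrite !lossQE (trmxK (W^T^T *m Pstar^T)).
  exact: (proj_loss_min Pstar^T SW B^T).
(* After cancelling the squared norm and [r], both positive, the claim is that [1/d < 1/m]. *)
- rewrite EUE EQE lte_fin ltr_pM2r.
    rewrite ltrD2l ltrN2 ltr_pM2l// ltf_pV2 ?ltr_nat// posrE ltr0n.
      exact: leq_ltn_trans hmd.
    exact: leq_trans hrm.
  rewrite exprn_gt0// lt_neqAle sqrtr_ge0 andbT eq_sym sqrtr_eq0 -ltNge.
  (* A nonzero entry of [Pstar] makes the sum of squares positive. *)
  have [i [j Pij]] : exists i, exists j, Pstar i j != 0.
    apply: contrapT => P0; move/eqP: hP; apply; apply/matrixP => i j.
    rewrite mxE; apply: contrapT => /eqP Pij; apply: P0; by exists i, j.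
  rewrite (bigD1 i)//= (bigD1 j)//= -addrA ltr_wpDr//.
    by rewrite addr_ge0// !sumr_ge0// => *; rewrite ?sumr_ge0// => *; exact: sqr_ge0.
  by rewrite exprn_even_gt0.
Qed.
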